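(* Let $(X,d_X)$ and $(Y,d_Y)$ be nonempty metric spaces which are weak equivalent. Suppose that the equivalence $$0\in\mathrm{ac}(D(X))\ \Leftrightarrow\ 0\in\mathrm{ac}(D(Y))$$ holds. Then $X$ and $Y$ are homeomorphic.
   Context: The distance set of a nonempty metric space is $D(X)=\{d(x,y):x,y\in X\}$. A surjective mapping $\Phi:X\to Y$ between nonempty metric spaces is a weak similarity if there is a strictly increasing function $f:D(Y)\to D(X)$ such that $d_X(x,y)=f(d_Y(\Phi(x),\Phi(y)))$ for all $x,y\in X$. $X$ and $Y$ are weak equivalent if there is a weak similarity $\Phi:X\to Y$. For $A\subseteq[0,\infty)$, $\mathrm{ac}(A)$ is the set of all accumulation points of $A$ in $[0,\infty)$ with the standard topology. *)

(* Defs.v *)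
From mathcomp Require Import all_boot all_order all_algebra.
From mathcomp Require Import all_classical all_reals all_analysis.

Set Implicit Arguments.
Unset Strict Implicit.
Unset Printing Implicit Defensive.

Import Order.TTheory GRing.Theory Num.Theory.
Import numFieldNormedType.Exports.

Local Open Scope classical_set_scope.
Local Open Scope ring_scope.

Definition distance_set (R : realType) (X : metricType R) : set R :=
  [set mdist x y | x in [set: X] & y in [set: X]].

(* The increasing function D(Y) -> D(X) is encoded as a total function on R;
   only its values on D(Y) are constrained. *)
Definition weak_similarity (R : realType) (X Y : metricType R)
    (Phi : X -> Y) : Prop :=
  set_surj [set: X] [set: Y] Phi /\
  exists f : R -> R,
    [/\ set_fun (distance_set Y) (distance_set X) f,
        {in distance_set Y &, {homo f : s t / s < t}} &
        forall x y : X, mdist x y = f (mdist (Phi x) (Phi y))].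

Definition weak_equivalent (R : realType) (X Y : metricType R) : Prop :=
  exists Phi : X -> Y, weak_similarity Phi.

(* [subspace `[0, +oo[] is R with every negative point made isolated, so no
   negative point is a limit point; at p >= 0 the neighbourhoods are the
   relative ones. *)
Definition ac (R : realType) (A : set R) : set R :=
  @limit_point (subspace (`[0, +oo[%classic : set R)) A.

Definition homeomorphic (S T : topologicalType) : Prop :=
  exists (h : S -> T) (g : T -> S),
    [/\ cancel h g, cancel g h, continuous h & continuous g].

(* Main.v *)
(** A weak similarity is a bijection that preserves and reflects the strict
order between distances. Let [h] be a bijection preserving this order. If the
target has arbitrarily small positive distances [d(h z, h w)], then the ball of
radius [d(z, w)] around any [x] is mapped into the ball of radius [d(h z, h w)]
around [h x], so [h] is continuous. Otherwise, by the hypothesis on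
accumulation at 0, the source has no small positive distances either, hence it
is discrete and [h] is trivially continuous. *)
Require Import Defs.
From mathcomp Require Import all_boot all_order all_algebra.
From mathcomp Require Import all_classical all_reals all_analysis.
Import Order.TTheory GRing.Theory Num.Theory.
Import numFieldNormedType.Exports.

Local Open Scope classical_set_scope.
Local Open Scope ring_scope.

(** Distances are nonnegative, so one that differs from 0 and lies below [e] is positive. Since 0
    belongs to the half-line, its neighbourhoods in the subspace are the relative ones. *)
Lemma ac_distance_set0P (R : realType) (X : metricType R) :
  ac (distance_set X) 0 <->
  forall e : R, 0 < e -> exists x y : X, 0 < mdist x y < e.
Proof.
set A : set R := `[0, +oo[%classic.
have A0 : A 0 by rewrite /A /= in_itv /= lexx.
have nbhs0E : @nbhs _ (subspace A) (0 : R) = within A (nbhs (0 : R)).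
  by rewrite (nbhs_subspace_in A0).
split=> [ac0 e e_gt0|small U].
  have U0 : @nbhs _ (subspace A) (0 : R) [set t : R | t < e].
    by rewrite nbhs0E; apply: filterS (lt_nbhsl e_gt0) => t t_lt _.
  have [t [t_neq0 [x _ [y _ xyt]] t_lt]] := ac0 _ U0.
  exists x, y; rewrite lt_neqAle mdist_ge0 andbT xyt eq_sym.
  by apply/andP; split.
rewrite [X in X -> _](_ : _ = within A (nbhs (0 : R)) U); last first.
  by rewrite -nbhs0E.
move=> -[e /= e_gt0 eU].
have [x [y /andP[xy_gt0 xy_lt]]] := small e e_gt0.
exists (mdist x y); split; first by rewrite gt_eqF.
  by exists x => //; exists y.
apply: eU; last by rewrite /A /= in_itv /= andbT ltW.
by rewrite /= sub0r normrN gtr0_norm.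
Qed.

(** One-sided form, applied to the weak similarity and to its inverse, each time with one direction
    of the equivalence. *)
Lemma continuous_of_mdist_homo (R : realType) (S T : metricType R)
    (h : S -> T) :
  set_surj [set: S] [set: T] h ->
  (forall x y z w : S,
    mdist x y < mdist z w -> mdist (h x) (h y) < mdist (h z) (h w)) ->
  (ac (distance_set S) 0 -> ac (distance_set T) 0) ->
  continuous h.
Proof.
move=> h_surj h_homo acST x; apply/metricType_numDomainType.cvgrPdist_lt => e e_gt0.
have near_mdist (r : R) : 0 < r -> \forall y \near x, mdist x y < r.
  by move=> r_gt0; apply/metricType_numDomainType.nbhs_mdistP; exists r.
have [/acST/ac_distance_set0P/(_ e e_gt0)|] :=
  pselect (ac (distance_set S) 0).
  move=> [u [v]].
  have [z _ <-] := h_surj u I; have [w _ <-] := h_surj v I.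
  move=> /andP[hzw_gt0 hzw_lt].
  have zw_gt0 : 0 < mdist z w.
    by rewrite mdist_gt0; apply: contraTneq hzw_gt0 => ->; rewrite mdistxx ltxx.
  apply: filterS (near_mdist _ zw_gt0) => y xy_lt.
  exact: lt_trans (h_homo _ _ _ _ xy_lt) hzw_lt.
move=> not_acS.
(* A single [r] serves all points: every ball of radius [r] is a singleton. *)
have [r r_gt0 gap] : exists2 r : R, 0 < r &
    forall y z : S, mdist y z < r -> y = z.
  apply: contrapT => no_gap; apply: not_acS.
  apply/ac_distance_set0P => r r_gt0.
  apply: contrapT => none; apply: no_gap; exists r => // y z yz_lt.
  apply/eqP/negPn/negP => yz_neq; apply: none.
  by exists y, z; rewrite mdist_gt0 yz_neq yz_lt.
by apply: filterS (near_mdist _ r_gt0) => y /gap <-; rewrite mdistxx.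
Qed.

(** Points with the same image are at distance [f 0], which is 0 because [f 0] is also the distance
    from [x] to itself. *)
Lemma weak_similarity_inj (R : realType) (X Y : metricType R) (Phi : X -> Y) :
  weak_similarity Phi -> injective Phi.
Proof.
move=> [_ [f [_ _ fE]]] x y Pxy; apply: mdist_positivity.
by rewrite fE Pxy -fE mdistxx.
Qed.

Lemma weak_similarity_ltE (R : realType) (X Y : metricType R) (Phi : X -> Y) :
  weak_similarity Phi -> forall x y z w : X,
  (mdist (Phi x) (Phi y) < mdist (Phi z) (Phi w)) = (mdist x y < mdist z w).
Proof.
move=> [_ [f [_ f_homo fE]]] x y z w; rewrite !fE.
have inD u v : mdist (Phi u) (Phi v) \in distance_set Y.
  by apply/mem_set; exists (Phi u) => //; exists (Phi v).
(* Distances are totally ordered, so the strictly increasing [f] also reflects the strict order. *)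
by rewrite (leW_mono_in (le_mono_in f_homo)).
Qed.

Theorem proposition2p1 (R : realType) (X Y : metricType R)
    (X_neq0 : [set: X] !=set0) (Y_neq0 : [set: Y] !=set0)
    (XY : weak_equivalent X Y)
    (ac0 : ac (distance_set X) 0 <-> ac (distance_set Y) 0) :
  homeomorphic X Y.
Proof.
have [Phi Phi_ws] := XY.
have Phi_surj : set_surj [set: X] [set: Y] Phi by case: Phi_ws.
have Phi_lt := weak_similarity_ltE _ _ _ _ Phi_ws.
pose g y := s2val (cid2 (Phi_surj y I)).
have gK : cancel g Phi by move=> y; exact: s2valP' (cid2 (Phi_surj y I)).
have PhiK : cancel Phi g.
  by move=> x; apply: (weak_similarity_inj _ _ _ _ Phi_ws); rewrite gK.
exists Phi, g; split => //.
  apply: continuous_of_mdist_homo => // [x y z w|/ac0//].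
  by rewrite Phi_lt.
apply: continuous_of_mdist_homo => [x _|x y z w|/ac0//].
  by exists (Phi x).
by rewrite -Phi_lt !gK.
Qed.
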